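(* Let $\mathbb{H}$ be a Hilbert space and let $S$ be a positive linear operator on $\mathbb{H}$ (defined on a linear subspace $\operatorname{dom}(S)\subseteq\mathbb{H}$). Then the following are equivalent: (1) $\operatorname{dom}(S)^\perp=\{0\}$ and $S^*=S$; (2) $\{k+l: \{k,l\}\in G(S)\cap G(S)^*\}=\mathbb{H}$.
   Context: A linear operator $S$ on $\mathbb{H}$ is a linear map $S:\operatorname{dom}(S)\to\mathbb{H}$, where $\operatorname{dom}(S)$ is a linear subspace of $\mathbb{H}$; it is not assumed to be everywhere defined, densely defined, closed or bounded. $S$ is positive if $\langle Sf,f\rangle\ge 0$ for all $f\in\operatorname{dom}(S)$. Ordered pairs in $\mathbb{H}\times\mathbb{H}$ are written $\{f,f'\}$. The graph of $S$ is $G(S)=\{\{f,Sf\}: f\in\operatorname{dom}(S)\}$. The adjoint of the graph is defined, whether or not $S$ is densely defined, by $$G(S)^*=\{\{f,f'\}\in\mathbb{H}\times\mathbb{H}: \langle f',h\rangle=\langle f,Sh\rangle \text{ for all } h\in\operatorname{dom}(S)\}.$$ If the adjoint operator $S^*$ exists, i.e. if $\operatorname{dom}(S)$ is dense (equivalently $\operatorname{dom}(S)^\perp=\{0\}$), then $G(S^* )=G(S)^*$. Equality $S^*=S$ means equality as (possibly unbounded) operators, including equality of domains. *)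

(* Defs.v *)
From HB Require Import structures.
From mathcomp Require Import all_boot all_order all_algebra sesquilinear.
From mathcomp Require Import complex.
From mathcomp Require Import all_classical all_reals topology normedtype.

Set Implicit Arguments.
Unset Strict Implicit.
Unset Printing Implicit Defensive.

Import Order.TTheory GRing.Theory Num.Theory.
Import numFieldNormedType.Exports.

Local Open Scope classical_set_scope.
Local Open Scope ring_scope.

(* The pair (K, theta) is meant to be (R, idfun) or (R[i], conjC) with R a
   realType.  The inner product is linear in its first argument and
   theta-semilinear in its second one. *)
Record hilbertSpace (K : numFieldType) (theta : K -> K) := HilbertSpace {
  hilbert_sort :> completeNormedModType K ;
  inner : {dot hilbert_sort for theta} ;
  inner_norm : forall x : hilbert_sort, inner x x = `|x| ^+ 2
}.

Definition realHilbertSpace (R : realType) := @hilbertSpace R idfun.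
Definition complexHilbertSpace (R : realType) :=
  @hilbertSpace (complex R) (@Num.conj (complex R)).

Section Operators.
Variables (K : numFieldType) (theta : K -> K) (H : hilbertSpace theta).

Local Notation "'[ u , v ]" := (inner H u v) : ring_scope.

Lemma innerPl (a : K) (u v w : H) : '[a *: u + v, w] = a * '[u, w] + '[v, w].
Proof. exact: linearPl. Qed.

Lemma innerBl (u v w : H) : '[u - v, w] = '[u, w] - '[v, w].
Proof. exact: linearBl. Qed.

Lemma inner0l (w : H) : '[0, w] = 0.
Proof. exact: linear0l. Qed.

(* The values of [op] outside [dom] are irrelevant: operators are compared
   with [op_eq] below, never with Leibniz equality. *)
Record linearOperator := LinearOperator {
  dom : set H ;
  op :> H -> H ;
  dom_submod : GRing.submod_closed [in dom] ;
  op_linear : forall a : K,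
    {in dom &, forall u v, op (a *: u + v) = a *: op u + op v}
}.

Definition op_eq (S T : linearOperator) : Prop :=
  dom S = dom T /\ {in dom S, S =1 T}.

Definition positive_op (S : linearOperator) : Prop :=
  {in dom S, forall f, 0 <= '[S f, f]}.

Definition orthogonal_compl (A : set H) : set H :=
  [set g | forall h, A h -> '[g, h] = 0].

Definition graph (S : linearOperator) : set (H * H) :=
  [set (f, S f) | f in dom S].

Definition adjoint_graph (S : linearOperator) : set (H * H) :=
  [set p | forall h, dom S h -> '[p.2, h] = '[p.1, S h]].

Lemma adjoint_graph_linear (S : linearOperator) (a : K) (f f' g g' : H) :
  adjoint_graph S (f, f') -> adjoint_graph S (g, g') ->
  adjoint_graph S (a *: f + g, a *: f' + g').
Proof.
move=> Sf Sg h hS; have /= Sfh := Sf h hS; have /= Sgh := Sg h hS.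
by rewrite /= !innerPl Sfh Sgh.
Qed.

Lemma adjoint_graph_functional (S : linearOperator) (f f' f'' : H) :
  orthogonal_compl (dom S) = [set 0] ->
  adjoint_graph S (f, f') -> adjoint_graph S (f, f'') -> f' = f''.
Proof.
move=> S0 Sf' Sf''; apply/eqP; rewrite -subr_eq0; apply/eqP.
have : orthogonal_compl (dom S) (f' - f'').
  move=> h hS; have /= Sfh' := Sf' h hS; have /= Sfh'' := Sf'' h hS.
  by rewrite innerBl Sfh' Sfh'' subrr.
by rewrite S0.
Qed.

Section Adjoint.
Variables (S : linearOperator) (S0 : orthogonal_compl (dom S) = [set 0]).

Definition adjoint_dom : set H :=
  [set f | exists f', adjoint_graph S (f, f')].

Definition adjoint_fun (f : H) : H :=
  xget 0 [set f' | adjoint_graph S (f, f')].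

Lemma adjoint_funP (f : H) :
  adjoint_dom f -> adjoint_graph S (f, adjoint_fun f).
Proof. exact: xgetPex. Qed.

Lemma adjoint_dom_submod : GRing.submod_closed [in adjoint_dom].
Proof.
split=> [|a f g].
  by apply/mem_set; exists 0 => h hS /=; rewrite !inner0l.
move=> /set_mem[f' Sf] /set_mem[g' Sg]; apply/mem_set.
by exists (a *: f' + g'); exact: adjoint_graph_linear.
Qed.

Lemma adjoint_fun_linear (a : K) :
  {in adjoint_dom &, forall u v,
    adjoint_fun (a *: u + v) = a *: adjoint_fun u + adjoint_fun v}.
Proof.
move=> u v /set_mem Du /set_mem Dv.
have Suv := adjoint_graph_linear a (adjoint_funP Du) (adjoint_funP Dv).
apply: (adjoint_graph_functional S0 _ Suv); apply: adjoint_funP.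
by exists (a *: adjoint_fun u + adjoint_fun v).
Qed.

(* The adjoint operator exists only under [S0], which makes [adjoint_graph S]
   the graph of an operator. *)
Definition adjoint : linearOperator :=
  LinearOperator adjoint_dom_submod adjoint_fun_linear.

Lemma graph_adjoint : graph adjoint = adjoint_graph S.
Proof.
apply/seteqP; split=> [_ [f Df <-]|[f f'] Sf].
  exact: adjoint_funP.
have Df : adjoint_dom f by exists f'.
by exists f => //; rewrite (adjoint_graph_functional S0 Sf (adjoint_funP Df)).
Qed.

End Adjoint.

End Operators.

(* Main.v *)
(* Positivity gives <f + S f, f> >= |f|^2, so I + S is injective on dom S and
   its inverse is a contraction.
   If S is self-adjoint, a vector g orthogonal to ran(I + S) satisfies
   {g, - g} in G(S)^* = G(S), hence g = 0, and ran(I + S) is dense. It is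
   closed because (I + S)^-1 is a contraction and G(S) = G(S)^* is closed, so
   it is H.
   Conversely, let k in dom S with {k, S k} in G(S)^* solve k + S k = f + S f;
   injectivity gives k = f, so S is symmetric. Solving k + S k = g for
   g orthogonal to dom S and pairing with k gives k = 0, hence g = 0. Finally,
   for {f, f'} in G(S)^*, the solution k of k + S k = f + f' has k - f orthogonal to
   ran(I + S) = H, so {f, f'} = {k, S k}. *)

Require Import Defs.
From mathcomp Require Import all_boot all_order all_algebra.
From mathcomp Require Import all_classical all_reals topology normedtype.
From mathcomp Require Import sesquilinear complex ring.

Set Implicit Arguments.
Unset Strict Implicit.
Unset Printing Implicit Defensive.

Import Order.TTheory GRing.Theory Num.Theory.
Import numFieldNormedType.Exports.

Local Open Scope classical_set_scope.
Local Open Scope ring_scope.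

(** * Infima of sets of nonnegative scalars *)

(* The completeness of the scalars, phrased so that it holds for [R] and for
   the partially ordered field [R[i]] alike. *)
Definition nonneg_inf_approx (K : numFieldType) :=
  forall A : set K, A !=set0 -> (forall a, A a -> 0 <= a) ->
  exists m, (forall a, A a -> m <= a) /\
    (forall d, 0 < d -> exists2 a, A a & a < m + d).

Lemma real_nonneg_inf_approx (R : realType) : nonneg_inf_approx R.
Proof.
move=> A A0 Age0.
have Ainf : has_inf A by split => //; exists 0 => a /Age0.
exists (inf A); split=> [a Aa|d d0]; first exact: ge_inf Ainf.2 _ Aa.
by have [a Aa lta] := inf_adherent d0 Ainf; exists a.
Qed.

(** Nonnegative elements of [R[i]] are real, so [A] is the image of a set of reals; a positive [d]
    is real as well. *)
Lemma complex_nonneg_inf_approx (R : realType) :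
  nonneg_inf_approx (complex R).
Proof.
move=> A [a0 Aa0] Age0.
pose B : set R := [set x | A x%:C%C].
have AB a : A a -> exists2 x, B x & a = x%:C%C.
  move=> Aa; have /RRe_real ra := ger0_real (Age0 _ Aa).
  by exists (complex.Re a); rewrite /B /= ?ra.
have B0 : B !=set0 by have [x Bx _] := AB _ Aa0; exists x.
have Bge0 x : B x -> 0 <= x by move=> /Age0; rewrite (lecR 0).
have [m [mB Bm]] := real_nonneg_inf_approx B0 Bge0.
exists m%:C%C; split=> [a /AB[x Bx ->]|d d0]; first by rewrite lecR mB.
have /RRe_real dr := gtr0_real d0; move: d0; rewrite -dr (ltcR 0) => d0.
have [x Bx ltx] := Bm _ d0; exists x%:C%C => //.
by rewrite -rmorphD ltcR.
Qed.

(** * Orthogonality and the Cauchy-Schwarz inequality *)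

Section InnerProduct.
Variables (K : numFieldType) (theta : K -> K) (H : hilbertSpace theta).
Implicit Types (u v w x : H) (M : set H).

Local Notation "'[ u , v ]" := (inner H u v) : ring_scope.

Lemma submod_closed_comb M (a : K) u v :
  GRing.submod_closed [in M] -> M u -> M v -> M (a *: u + v).
Proof.
by move=> Mlin Mu Mv; apply/set_mem; apply: Mlin.2; apply/mem_set.
Qed.

Lemma innerDl u v w : '[u + v, w] = '[u, w] + '[v, w].
Proof. exact: linearDl. Qed.

Lemma innerDr u v w : '[u, v + w] = '[u, v] + '[u, w].
Proof. exact: linearDr. Qed.

Lemma innerNl u v : '[- u, v] = - '[u, v].
Proof. exact: linearNl. Qed.

Lemma innerNr u v : '[u, - v] = - '[u, v].
Proof. exact: linearNr. Qed.

Lemma innerZl (a : K) u v : '[a *: u, v] = a * '[u, v].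
Proof. exact: linearZl_LR. Qed.

Lemma inner_sym0 u v : '[u, v] = 0 -> '[v, u] = 0.
Proof.
move=> uv0; have innerC (a b : H) : '[a, b] = theta '[b, a].
  by rewrite (hermitian_subproof (s := inner H)) mul1r.
(* [theta 0 = 0] is read off from Hermitian symmetry at the pair [0, 0]. *)
by rewrite innerC uv0; have := innerC 0 0; rewrite !inner0l.
Qed.

Lemma inner_pythagoras u v :
  '[u, v] = 0 -> `|u + v| ^+ 2 = `|u| ^+ 2 + `|v| ^+ 2.
Proof.
move=> uv0; rewrite -!inner_norm innerDl !innerDr uv0 (inner_sym0 uv0).
by rewrite addr0 add0r.
Qed.

Lemma parallelogram u v :
  `|u + v| ^+ 2 + `|u - v| ^+ 2 = 2 * (`|u| ^+ 2 + `|v| ^+ 2).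
Proof.
by rewrite -!inner_norm !innerDl !innerDr !innerNl !innerNr; ring.
Qed.

(* [w - t *: x] is the component of [w] orthogonal to [x]. *)
Lemma orthogonal_line w x : exists t : K,
  `|x| ^+ 2 * `|w| ^+ 2 =
  `|x| ^+ 2 * `|w - t *: x| ^+ 2 + `|'[w, x]| ^+ 2.
Proof.
have [->|x0] := eqVneq x 0.
  exists 0; rewrite normr0 expr0n /= !mul0r add0r.
  by rewrite inner_sym0 ?inner0l// normr0 expr0n.
exists ('[w, x] / `|x| ^+ 2); set c := '[w, x]; set t := c / _.
have nx0 : `|x| != 0 by rewrite normr_eq0.
have zx : '[w - t *: x, x] = 0.
  by rewrite innerBl innerZl inner_norm divfK ?subrr ?expf_neq0.
have ztx : '[w - t *: x, t *: x] = 0.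
  by apply: inner_sym0; rewrite innerZl (inner_sym0 zx) mulr0.
rewrite -[in LHS](subrK (t *: x) w) (inner_pythagoras ztx) mulrDr; congr +%R.
by rewrite normrZ normrM normfV normrX normr_id; field.
Qed.

(** Drop the term of the orthogonal component in [orthogonal_line]. *)
Lemma cauchy_schwarz w x : `|'[w, x]| <= `|w| * `|x|.
Proof.
have [t e] := orthogonal_line w x.
rewrite -(@ler_pXn2r _ 2) ?nnegrE ?mulr_ge0// exprMn mulrC e lerDr.
by rewrite mulr_ge0 ?exprn_ge0.
Qed.

Lemma inner_continuous x : continuous (fun w => '[w, x]).
Proof.
move=> w; apply/cvgrPdist_lt => e e0; near=> v.
rewrite -innerBl (le_lt_trans (cauchy_schwarz _ _))//.
(* The [+ 1] keeps the divisor of [e] positive even when [x = 0]. *)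
rewrite (@le_lt_trans _ _ (`|w - v| * (`|x| + 1)))//.
  by rewrite ler_wpM2l// lerDl.
rewrite -ltr_pdivlMr ?ltr_wpDl//; near: v.
by apply: cvgr_dist_lt => //; rewrite divr_gt0 ?ltr_wpDl.
Unshelve. all: by end_near. Qed.

(** * Near-minimizers of the distance and orthogonal decomposition *)

Section NearestPoint.
Variables (M : set H) (g : H) (m : K).
Hypotheses (Mlin : GRing.submod_closed [in M])
  (mM : forall y, M y -> m <= `|g - y| ^+ 2).

(** Indexed by positive [d], these sets generate the filter that replaces a minimizing sequence. *)
Definition near_minimizers (d : K) : set H :=
  [set y | M y /\ `|g - y| ^+ 2 < m + d].

(** Parallelogram law for [g - y] and [g - x]: the midpoint of [x] and [y] lies in [M], so its
    squared distance to [g] is at least [m], which leaves less than [4 * (m + d) - 4 * m]. *)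
Lemma near_minimizers_close d x y :
  near_minimizers d x -> near_minimizers d y -> `|x - y| ^+ 2 < 4 * d.
Proof.
move=> [Mx dx] [My dy].
have M0 : M 0 by apply/set_mem; exact: Mlin.1.
have Mz : M (2^-1 *: x + (2^-1 *: y + 0)).
  by do 2! apply: submod_closed_comb => //.
have := parallelogram (g - y) (g - x).
have -> : g - y + (g - x) = (2 : K) *: (g - (2^-1 *: x + (2^-1 *: y + 0))).
  rewrite addr0 scalerBr scalerDr !scalerA mulfV ?pnatr_eq0// !scale1r.
  by rewrite scaler_nat mulr2n opprD addrACA [- y - x]addrC.
have -> : g - y - (g - x) = x - y by rewrite opprB addrC addrA subrK.
rewrite normrZ exprMn [`|2|]ger0_norm// => /(canRL (addKr _)) ->.
have -> : 4 * d = - (2 ^+ 2 * m) + 2 * ((m + d) + (m + d)) by ring.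
by rewrite ler_ltD// ?lerN2 ?ler_pM2l ?exprn_gt0 ?mM// ltr_pM2l ?ltrD.
Qed.

(** For the [t] of [orthogonal_line], [y + t *: x] is in [M], so moving there from [y] lowers the
    squared distance to [g] by at most [d]. *)
Lemma near_minimizers_orthogonal d x y :
  near_minimizers d y -> M x -> `|'[g - y, x]| ^+ 2 <= `|x| ^+ 2 * d.
Proof.
move=> [My dy] Mx; have [t e] := orthogonal_line (g - y) x.
rewrite -(lerD2l (`|x| ^+ 2 * `|g - y - t *: x| ^+ 2)) -e -mulrDr.
rewrite ler_wpM2l ?exprn_ge0// (le_trans (ltW dy))// lerD2r.
by rewrite -addrA -opprD mM// addrC; exact: submod_closed_comb.
Qed.

End NearestPoint.

Lemma orthogonal_decomposition M g :
  nonneg_inf_approx K -> GRing.submod_closed [in M] ->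
  exists2 p, closure M p & orthogonal_compl M (g - p).
Proof.
move=> infK Mlin.
have M0 : M 0 by apply/set_mem; exact: Mlin.1.
have [] := infK [set `|g - y| ^+ 2 | y in M].
- by exists (`|g - 0| ^+ 2); exists 0.
- by move=> _ [y _ <-]; rewrite exprn_ge0.
move=> m [mA Am].
have mM y : M y -> m <= `|g - y| ^+ 2 by move=> My; apply: mA; exists y.
pose F := filter_from [set d | 0 < d] (near_minimizers M g m).
have FF : ProperFilter F.
  apply: filter_from_proper; last first.
    by move=> d /Am[_ [y My <-] dy]; exists y.
  apply: filter_from_filter; first by exists 1; exact: ltr01.
  move=> c d /= c0 d0.
  (* The order on [K] may be partial, but positive scalars are real, hence comparable. *)
  have [cd|dc] := real_leP (gtr0_real c0) (gtr0_real d0).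
    by exists c => // y [My cy]; do 2! split=> //;
       rewrite (lt_le_trans cy)// lerD2l.
  by exists d => // y [My dy]; do 2! split=> //;
     rewrite (lt_trans dy)// ltrD2l.
have /cauchy_cvg /cvg_ex[p Fp] : cauchy F.
  (* This [d] turns the bound [4 * d] of [near_minimizers_close] into [e ^+ 2]. *)
  apply: cauchy_exP => e e0; have d0 : 0 < e ^+ 2 / 4.
    by rewrite divr_gt0 ?exprn_gt0.
  have [_ [x Mx <-] dx] := Am _ d0; exists x; exists (e ^+ 2 / 4) => // y dy.
  rewrite -ball_normE /= -(@ltr_pXn2r _ 2) ?nnegrE ?(ltW e0)//.
  have := near_minimizers_close Mlin mM (conj Mx dx) dy.
  by rewrite mulrC divfK ?pnatr_eq0.
exists p.
  rewrite closureEcvg; exists F => //; split=> // A MA.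
  by exists 1; [exact: ltr01|move=> y [/MA]].
move=> x Mx.
have lim : '[g - y, x] @[y --> F] --> '[g - p, x].
  apply: (@cvg_comp _ _ _ (fun y => g - y) (fun w => '[w, x]) _ (nbhs (g - p))).
    by apply: cvgB => //; exact: cvg_cst.
  exact: inner_continuous.
(* Near-minimizers are nearly orthogonal to [x]; uniqueness of limits then makes [g - p] orthogonal
   to [x]. *)
have lim0 : '[g - y, x] @[y --> F] --> (0 : K).
  apply/cvgr0Pnorm_lt => e e0; have x1 : 0 < `|x| ^+ 2 + 1.
    by rewrite ltr_wpDl ?exprn_ge0.
  have d0 : 0 < e ^+ 2 / (`|x| ^+ 2 + 1) by rewrite divr_gt0 ?exprn_gt0.
  exists (e ^+ 2 / (`|x| ^+ 2 + 1)) => // y dy /=.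
  rewrite -(@ltr_pXn2r _ 2) ?nnegrE ?(ltW e0)//.
  apply: le_lt_trans (near_minimizers_orthogonal Mlin mM dy Mx) _.
  by rewrite mulrCA gtr_pMr ?exprn_gt0// ltr_pdivrMr// mul1r ltrDl.
exact: (cvg_unique (@norm_hausdorff _ K) lim lim0).
Qed.

End InnerProduct.

(** * The range of [I + S] for a positive operator [S] *)

Section PositiveOperator.
Variables (K : numFieldType) (theta : K -> K) (H : hilbertSpace theta).
Implicit Types (S T : linearOperator H) (f g h : H).

Local Notation "'[ u , v ]" := (inner H u v) : ring_scope.

Lemma op_eqP S T : op_eq S T <-> graph S = graph T.
Proof.
split=> [[dST ST]|gST].
  rewrite /graph -dST; apply/seteqP; split=> _ [f Sf <-]; exists f => //;
    by rewrite ST// inE.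
have sub (S1 S2 : linearOperator H) f : graph S1 = graph S2 ->
    dom S1 f -> dom S2 f /\ S1 f = S2 f.
  move=> g12 Sf; have : graph S1 (f, S1 f) by exists f.
  by rewrite g12 => -[k Tk [<- <-]].
split; last by move=> f /set_mem /(sub _ _ _ gST)[].
by apply/seteqP; split=> f /sub => [/(_ _ gST)|/(_ _ (esym gST))] [].
Qed.

Lemma opB S f g : dom S f -> dom S g ->
  dom S (f - g) /\ S (f - g) = S f - S g.
Proof.
move=> /mem_set Sf /mem_set Sg.
have -> : f - g = -1 *: g + f by rewrite scaleN1r addrC.
rewrite op_linear//; split; last by rewrite scaleN1r addrC.
by apply: submod_closed_comb; [exact: dom_submod|exact: set_mem|exact: set_mem].
Qed.

Definition shifted_range S : set H := [set f + S f | f in dom S].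

Lemma shifted_range_submod S : GRing.submod_closed [in shifted_range S].
Proof.
have D0 := (dom_submod S).1.
split=> [|a _ _ /set_mem[f Sf <-] /set_mem[g Sg <-]]; apply/mem_set.
  exists 0; first exact/set_mem.
  have [_] := opB (set_mem D0) (set_mem D0).
  by rewrite !subrr => ->; rewrite addr0.
exists (a *: f + g).
  exact: (submod_closed_comb _ (dom_submod S)).
by rewrite (op_linear a (mem_set Sf) (mem_set Sg)) scalerDr addrACA.
Qed.

Lemma shifted_range_orthogonal S g :
  orthogonal_compl (shifted_range S) g <-> adjoint_graph S (g, - g).
Proof.
split=> [gS h Sh|gS _ [h Sh <-]].
  have /eqP := gS _ (ex_intro2 _ _ h Sh erefl).
  by rewrite innerDr addr_eq0 innerNl => /eqP ->; rewrite opprK.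
have /= := gS h Sh; rewrite innerNl innerDr => <-.
by rewrite subrr.
Qed.

(** Bound ['[f + S f, f]] above by Cauchy-Schwarz and cancel one norm of [f]. *)
Lemma positive_op_shift_norm S f : positive_op S -> dom S f ->
  `|f| <= `|f + S f|.
Proof.
move=> Spos Sf; have [->|f0] := eqVneq f 0; first by rewrite normr0.
have Sff : 0 <= '[S f, f] by apply: Spos; exact/mem_set.
rewrite -(@ler_pM2r _ `|f|) ?normr_gt0// (le_trans _ (cauchy_schwarz _ _))//.
rewrite innerDl inner_norm ger0_norm ?addr_ge0 ?exprn_ge0//.
by rewrite -expr2 lerDl.
Qed.

Lemma self_adjoint_shifted_range_closed S : positive_op S ->
  graph S = adjoint_graph S -> closure (shifted_range S) `<=` shifted_range S.
Proof.
move=> Spos selfS y; rewrite closureEcvg => -[G GG [Gy GS]].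
have GM : \forall z \near G, shifted_range S z by apply: GS => z.
(* [r] inverts [I + S] on its range; its values elsewhere do not matter. *)
have /choice[r rP] : forall z, exists f,
    shifted_range S z -> dom S f /\ f + S f = z.
  move=> z; have [[f Sf fz]|nz] := pselect (shifted_range S z).
    by exists f.
  by exists 0.
have r_contract z z' : shifted_range S z -> shifted_range S z' ->
    `|r z - r z'| <= `|z - z'|.
  move=> /rP[Sr rz] /rP[Sr' rz']; rewrite -{2}rz -{2}rz'.
  have [dB SB] := opB Sr Sr'.
  by rewrite opprD addrACA -SB; exact: positive_op_shift_norm.
have /cauchy_cvg /cvg_ex[f rf] : cauchy (r @ G).
  apply: cauchy_exP => e e0.
  (* Two points within [e / 2] of [y] are within [e] of each other, and [r] does not increase
     distances. *)
  have Gball : \forall z \near G, shifted_range S z /\ ball y (e / 2) z.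
    apply: filterI => //; apply: Gy; apply: nbhsx_ballx.
    by rewrite divr_gt0.
  have [z0 [Mz0 yz0]] := filter_ex Gball.
  exists (r z0); apply: filterS Gball => z [Mz yz].
  rewrite -ball_normE /=; apply: le_lt_trans (r_contract _ _ Mz0 Mz) _.
  have : ball z0 e z by apply: ball_splitr yz0 yz.
  by rewrite -ball_normE.
(* On the range [S (r z) = z - r z], and the symmetry of [S] passes to the limit along [G]. *)
have : adjoint_graph S (f, y - f).
  move=> h Sh /=.
  have lim1 : '[z - r z, h] @[z --> G] --> '[y - f, h].
    apply: (@cvg_comp _ _ _ (fun z => z - r z) (fun w => '[w, h]) _
      (nbhs (y - f))); first exact: cvgB.
    exact: inner_continuous.
  have lim2 : '[z - r z, h] @[z --> G] --> '[f, S h].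
    apply: (@cvg_trans _ ('[r z, S h] @[z --> G])).
      apply: near_eq_cvg; near=> z.
      have Mz : shifted_range S z by near: z.
      have [Srz rz] := rP _ Mz.
      have : adjoint_graph S (r z, S (r z)) by rewrite -selfS; exists (r z).
      by move=> /(_ h Sh) /= <-; rewrite -{2}rz [_ + S _]addrC addrK.
    apply: (@cvg_comp _ _ _ r (fun w => '[w, S h]) _ (nbhs f)) => //.
    exact: inner_continuous.
  exact: (cvg_unique (@norm_hausdorff _ K) lim1 lim2).
rewrite -selfS => -[k Sk [<- Sky]].
by exists k => //; rewrite Sky addrC subrK.
Unshelve. all: by end_near. Qed.

(** * Self-adjointness and surjectivity of [I + S] *)

Lemma self_adjoint_shifted_range S : nonneg_inf_approx K -> positive_op S ->
  graph S = adjoint_graph S -> shifted_range S = setT.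
Proof.
move=> infK Spos selfS; apply/seteqP; split=> // g _.
have [p /(self_adjoint_shifted_range_closed Spos selfS) Mp] :=
  orthogonal_decomposition g infK (shifted_range_submod S).
(* Here [k = g - p] and [S k = - k], so [k + S k = 0], which forces [k = 0] and [g = p]. *)
move=> /shifted_range_orthogonal; rewrite -selfS => -[k Sk [kE SkE]].
suff k0 : k = 0 by move: Mp; rewrite -[p](subKr g) -kE k0 subr0.
have := positive_op_shift_norm Spos Sk.
by rewrite SkE kE subrr normr0 normr_le0 -kE => /eqP.
Qed.

Lemma shifted_range_self_adjoint S : positive_op S ->
  [set kl.1 + kl.2 | kl in graph S `&` adjoint_graph S] = [set: H] ->
  orthogonal_compl (dom S) = [set 0] /\ graph S = adjoint_graph S.
Proof.
move=> Spos rangeT.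
have solve g : exists2 k, dom S k /\ adjoint_graph S (k, S k) & k + S k = g.
  have : [set: H] g by [].
  by rewrite -rangeT => -[_ [[k Sk <-] kS] <-]; exists k.
have shift_inj f k : dom S f -> dom S k -> f + S f = k + S k -> f = k.
  move=> Sf Sk e; have [Sfk eS] := opB Sf Sk.
  have := positive_op_shift_norm Spos Sfk.
  rewrite eS addrACA -opprD e subrr normr0 normr_le0 subr_eq0.
  by move/eqP.
have sym f : dom S f -> adjoint_graph S (f, S f).
  by move=> Sf; have [k [Sk kS] /esym/shift_inj->] := solve (f + S f).
split.
  apply/seteqP; split=> [g gS|_ -> h _]; last by rewrite inner0l.
  have [k [Sk _] kg] := solve g.
  (* Pairing [g = k + S k] with [k] gives a zero sum of two nonnegative terms. *)
  have := gS k Sk; rewrite -kg innerDl inner_norm => /eqP.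
  rewrite paddr_eq0 ?exprn_ge0//; last by apply: Spos; exact/mem_set.
  rewrite expf_eq0 normr_eq0 /= => /andP[/eqP k0 _].
  have [_] := opB Sk Sk; rewrite !subrr => S0.
  by rewrite k0 S0 addr0.
apply/seteqP; split=> [_ [f Sf <-]|[f f'] fS]; first exact: sym.
have [k [Sk kS] kE] := solve (f + f').
(* The second component is [S k - f'], rewritten by [k + S k = f + f']. *)
have : adjoint_graph S (k - f, - (k - f)).
  have := adjoint_graph_linear (-1) fS kS.
  rewrite !scaleN1r addrC [- f' + _]addrC.
  congr (adjoint_graph S (_, _)).
  by apply/eqP; rewrite opprB subr_eq addrAC eq_sym subr_eq -kE addrC.
move=> /shifted_range_orthogonal kf0.
have /eqP : k - f = 0.
  (* As [k - f] is itself in the range of [I + S], it is orthogonal to itself. *)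
  have [l [Sl _] lE] := solve (k - f).
  apply/eqP; rewrite -normr_eq0 -sqrf_eq0 -inner_norm -{2}lE; apply/eqP.
  by apply: kf0; exists l.
rewrite subr_eq0 => /eqP kf; exists f; first by rewrite -kf.
by move: kE; rewrite kf => /addrI ->.
Qed.

Lemma self_adjoint_iff_shifted_range S : nonneg_inf_approx K ->
  positive_op S ->
  (exists S0 : orthogonal_compl (dom S) = [set 0], op_eq (adjoint S0) S) <->
  [set kl.1 + kl.2 | kl in graph S `&` adjoint_graph S] = [set: H].
Proof.
move=> infK Spos; split=> [[S0 /op_eqP]|].
  rewrite graph_adjoint => selfS.
  rewrite -(self_adjoint_shifted_range infK Spos (esym selfS)) selfS setIid.
  apply/seteqP; split=> [_ [_ [f Sf <-] <-]|_ [f Sf <-]]; first by exists f.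
  by exists (f, S f) => //; exists f.
move=> /(shifted_range_self_adjoint Spos)[S0 selfS]; exists S0.
by apply/op_eqP; rewrite graph_adjoint.
Qed.

End PositiveOperator.

Theorem theorem2p7 (R : realType) :
  (forall (H : realHilbertSpace R) (S : linearOperator H), positive_op S ->
     ((exists S0 : orthogonal_compl (dom S) = [set 0], op_eq (adjoint S0) S)
      <->
      [set kl.1 + kl.2 | kl in graph S `&` adjoint_graph S] = [set: H]))
  /\
  (forall (H : complexHilbertSpace R) (S : linearOperator H), positive_op S ->
     ((exists S0 : orthogonal_compl (dom S) = [set 0], op_eq (adjoint S0) S)
      <->
      [set kl.1 + kl.2 | kl in graph S `&` adjoint_graph S] = [set: H])).
Proof.
split=> H S; apply: self_adjoint_iff_shifted_range.
  exact: real_nonneg_inf_approx.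
exact: complex_nonneg_inf_approx.
Qed.
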